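(* For every positive integer $k$, the complete tripartite graphs $K_{9k,13k,19k}$ and $K_{11k,13k,23k}$ have decompositions into $5$-cycles. (In particular, $K_{9,13,19}$ and $K_{11,13,23}$ do.)
   Context: $K_{r,s,t}$ denotes the complete tripartite graph with parts of sizes $r,s,t$. A decomposition of a graph into $5$-cycles is a partition of its edge set into edge sets of cycles of length $5$. A multiple of $K_{r,s,t}$ is a graph $K_{kr,ks,kt}$ with $k$ a positive integer. *)

(* Defs.v *)
From mathcomp Require Import all_boot.

Set Implicit Arguments.
Unset Strict Implicit.
Unset Printing Implicit Defensive.

(* A simple graph is given by its adjacency relation [e] on a finite vertex
   type; an edge is the unordered pair of its endpoints. *)
Definition edges (T : finType) (e : rel T) : {set {set T}} :=
  [set [set p.1; p.2] | p : T * T & e p.1 p.2].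

(* [c] is read cyclically: consecutive vertices are joined, and so are the
   last and the first. *)
Definition cycle_edges (T : finType) (c : seq T) : {set {set T}} :=
  [set [set x; next c x] | x in c].

(* For [n >= 3]: [F] is the edge set of a cycle of length [n] of the graph. *)
Definition is_ncycle (T : finType) (e : rel T) (n : nat)
    (F : {set {set T}}) : Prop :=
  exists2 c : n.-tuple T, ucycle e c & F = cycle_edges c.

Definition ncycle_decomposition (T : finType) (e : rel T) (n : nat)
    (P : {set {set {set T}}}) : Prop :=
  partition P (edges e) /\ (forall F, F \in P -> is_ncycle e n F).

Definition has_5cycle_decomposition (T : finType) (e : rel T) : Prop :=
  exists P : {set {set {set T}}}, ncycle_decomposition e 5 P.

Definition tri_vertex (r s t : nat) : finType := ('I_r + 'I_s + 'I_t)%type.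

Definition tri_part (r s t : nat) (v : tri_vertex r s t) : nat :=
  match v with
  | inl (inl _) => 0
  | inl (inr _) => 1
  | inr _ => 2
  end.

Definition complete_tripartite (r s t : nat) : rel (tri_vertex r s t) :=
  fun u v => tri_part u != tri_part v.
Arguments complete_tripartite r s t : clear implicits.

Lemma complete_tripartite_sym r s t : symmetric (complete_tripartite r s t).
Proof. by move=> u v; rewrite /complete_tripartite eq_sym. Qed.

Lemma complete_tripartite_irr r s t : irreflexive (complete_tripartite r s t).
Proof. by move=> u; rewrite /complete_tripartite eqxx. Qed.

(* Main.v *)
Require Import Defs.
From mathcomp Require Import all_boot.
From mathcomp Require Import ssralg zmodp matrix.

Set Implicit Arguments.
Unset Strict Implicit.
Unset Printing Implicit Defensive.

(** A decomposition of a small graph spreads to all its blow-ups, so only two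
    decompositions have to be produced.

    Replace every vertex [x] of a graph by [k] copies [(x, a)], with [a] in
    [Z/k], and join [(x, a)] to [(y, b)] whenever [x] and [y] are adjacent.
    Blowing up [K_(r, s, t)] gives [K_(rk, sk, tk)].  A 5-cycle
    [v0 v1 v2 v3 v4] becomes a graph with [5 k^2] edges, which is the union of
    the [k^2] edge-disjoint 5-cycles
      [(v0, a) (v1, b) (v2, a) (v3, b) (v4, a + b)],   [a, b] in [Z/k]:
    two consecutive second coordinates form one of the pairs [(a, b)],
    [(b, a)], [(b, a + b)], [(a + b, a)], and each of them determines [(a, b)]
    and takes every value.  Hence each of the [k^2] edges above a given edge
    of the 5-cycle lies on exactly one of the lifted cycles
    ([sdarts_lift_inj], [mem_sdarts_lift]); [blow_up_decomposition] follows.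

    It remains to decompose [K_(9,13,19)], with 535 edges, into 107 cycles and
    [K_(11,13,23)], with 695 edges, into 139 cycles.  Such decompositions are
    given explicitly.  That they are correct is a statement about lists of
    labels: the ordered pairs of vertices that are consecutive on the listed
    cycles, read in both directions, are, up to the order of the list, all
    ordered pairs of vertices from distinct parts, each occurring once
    ([labelled_decomposition]).  Sorting turns this into an equality of two
    lists, which is settled by computation. *)

(** * Decompositions as families of vertex sequences *)

(** The sets of edges of a decomposition are inconvenient to compute with; here
    each of them is represented by one of the vertex sequences that trace it. *)
Definition cycle_system (T : finType) (e : rel T) (n : nat)
    (C : {set n.-tuple T}) : Prop :=
  [/\ {in C, forall c : n.-tuple T, ucycle e c},
      {in C &, forall (c c' : n.-tuple T) E,
         E \in cycle_edges c -> E \in cycle_edges c' -> c = c'} &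
      forall x y, e x y ->
        exists2 c : n.-tuple T, c \in C & [set x; y] \in cycle_edges c].

Lemma cycle_edges_sub (T : finType) (e : rel T) (s : seq T) :
  cycle e s -> cycle_edges s \subset edges e.
Proof.
move=> es; apply/subsetP=> E /imsetP[x xs ->].
by apply/imsetP; exists (x, next s x); rewrite // inE next_cycle.
Qed.

Lemma cycle_system_decomposition (T : finType) (e : rel T) (n : nat)
    (C : {set n.-tuple T}) :
  0 < n -> cycle_system e C ->
  ncycle_decomposition e n [set cycle_edges (c : n.-tuple T) | c in C].
Proof.
move=> n_gt0 [Ccyc Cinj Ccov]; split; last first.
  by move=> F /imsetP[c cC ->]; exists c => //; apply: Ccyc.
apply/and3P; split.
- rewrite eqEsubset; apply/andP; split; apply/subsetP=> E.
    case/bigcupP=> F /imsetP[c cC ->]; apply: subsetP.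
    by apply: cycle_edges_sub; case/andP: (Ccyc c cC).
  case/imsetP=> -[x y]; rewrite inE /= => exy ->.
  have [c cC Ec] := Ccov x y exy.
  by apply/bigcupP; exists (cycle_edges c) => //; apply: imset_f.
- apply/trivIsetP=> _ _ /imsetP[c cC ->] /imsetP[c' cC' ->] neq.
  rewrite -setI_eq0; apply/eqP/setP=> E; rewrite !inE.
  apply/negP=> /andP[Ec Ec']; case/eqP: neq.
  by rewrite (Cinj c c' cC cC' E Ec Ec').
- apply/imsetP=> -[c _ /setP/(_ [set tnth c (Ordinal n_gt0);
                                 next c (tnth c (Ordinal n_gt0))])].
  by rewrite inE => /esym/negbT/negP; apply; apply: imset_f; apply: mem_tnth.
Qed.

Lemma decomposition_cycle_system (T : finType) (e : rel T) (n : nat)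
    (P : {set {set {set T}}}) :
  ncycle_decomposition e n P -> exists C : {set n.-tuple T}, cycle_system e C.
Proof.
case=> /and3P[/eqP coverP trivP _] cycP.
pose orient F := [pick c : n.-tuple T | ucycleb e c && (F == cycle_edges c)].
have orientP F : F \in P ->
    exists2 c, orient F = Some c & ucycle e c /\ F = cycle_edges c.
  rewrite /orient => /cycP[c0 c0cyc defF]; case: pickP => [c|/(_ c0)].
    by case/andP=> ? /eqP ?; exists c.
  by rewrite (c0cyc : ucycleb e c0) defF eqxx.
exists [set c | Some c \in orient @: P]; split.
- move=> c; rewrite inE => /imsetP[F FP def_c].
  by have [c'] := orientP F FP; rewrite -def_c => -[->] [].
- move=> c c'; rewrite !inE => /imsetP[F FP def_c] /imsetP[F' FP' def_c'] E.
  have [c1] := orientP F FP; rewrite -def_c => -[<-] [_ <-] EF.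
  have [c2] := orientP F' FP'; rewrite -def_c' => -[<-] [_ <-] EF'.
  suff eqF: F = F' by apply: Some_inj; rewrite def_c def_c' eqF.
  by rewrite -(def_pblock trivP FP EF) -(def_pblock trivP FP' EF').
- move=> x y exy.
  have: [set x; y] \in cover P.
    by rewrite coverP; apply/imsetP; exists (x, y); rewrite ?inE.
  case/bigcupP=> F FP EF; have [c def_c [_ eqF]] := orientP F FP.
  by exists c; rewrite -?eqF // inE -def_c; apply: imset_f.
Qed.

(** * Oriented edges of a cycle *)

Definition darts (T : Type) (s : seq T) : seq (T * T) := zip s (rot 1 s).

Lemma darts_map (T U : Type) (f : T -> U) (s : seq T) :
  darts (map f s) = [seq (f d.1, f d.2) | d <- darts s].
Proof.
rewrite /darts -map_rot.
by elim: s (rot 1 s) => [|x s IH] [|y t] //=; rewrite IH.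
Qed.

(** Both orientations are kept, so that membership in [sdarts s] does not depend
    on the order in which the ends of an edge are given. *)
Definition sdarts (T : Type) (s : seq T) : seq (T * T) :=
  darts s ++ [seq (d.2, d.1) | d <- darts s].

Lemma sdarts_map (T U : Type) (f : T -> U) (s : seq T) :
  sdarts (map f s) = [seq (f d.1, f d.2) | d <- sdarts s].
Proof. by rewrite /sdarts darts_map map_cat -!map_comp. Qed.

Lemma cycle_darts (T : eqType) (e : rel T) (s : seq T) :
  cycle e s = all (fun d => e d.1 d.2) (darts s).
Proof.
case: s => // x s; rewrite /darts rot1_cons.
suff gen y: path e y (rcons s x)
    = all (fun d => e d.1 d.2) (zip (y :: s) (rcons s x)) by exact: gen.
by elim: s y => [|z s IH] y //=; rewrite IH.
Qed.

Lemma darts_next (T : eqType) (s : seq T) :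
  uniq s -> darts s = [seq (x, next s x) | x <- s].
Proof.
case: s => // x0 s Us; rewrite /darts rot1_cons.
apply: (@eq_from_nth _ (x0, x0)).
  by rewrite size_zip size_rcons size_map minnn.
move=> i; rewrite size_zip size_rcons minnn => lt_i.
rewrite nth_zip ?size_rcons // (nth_map x0) //.
rewrite next_nth mem_nth // index_uniq // nth_rcons; congr (_, _).
case: ltngtP => // [|->]; last by rewrite nth_default.
by move=> lt_si; move: lt_i; rewrite ltnS leqNgt lt_si.
Qed.

Lemma set2_inj (T : finType) (x y x' y' : T) :
  [set x; y] = [set x'; y'] -> (x, y) = (x', y') \/ (x, y) = (y', x').
Proof.
move=> eqE; have := set21 x y; have := set22 x y; have := set21 x' y'.
have := set22 x' y'; rewrite eqE -{1 2}eqE.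
by do 4![case/set2P=> ?]; subst; auto.
Qed.

Lemma mem_cycle_edges (T : finType) (s : seq T) (x y : T) :
  uniq s -> ([set x; y] \in cycle_edges s) = ((x, y) \in sdarts s).
Proof.
move=> Us; rewrite /sdarts darts_next // mem_cat; apply/imsetP/orP.
  case=> z zs /set2_inj[] [-> ->]; [left | right].
    by apply: map_f.
  by apply/mapP; exists (z, next s z) => //; apply: map_f.
case=> [/mapP[z zs [-> ->]] | /mapP[_ /mapP[z zs ->] [-> ->]]]; exists z => //.
by rewrite setUC.
Qed.

(** * Blowing up a decomposition *)

Import GRing.Theory.

Section BlowUp.

Variables (T0 T : finType) (k : nat) (f : T0 * 'I_k.+1 -> T).

Definition heights (p : 'I_k.+1 * 'I_k.+1) : 5.-tuple 'I_k.+1 :=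
  [tuple p.1; p.2; p.1; p.2; (p.1 + p.2)%R].

Definition lift_cycle (c : 5.-tuple T0) (p : 'I_k.+1 * 'I_k.+1) : 5.-tuple T :=
  [tuple of map f (zip c (heights p))].

(** Every edge above an edge of [c] is covered by a lift of [c]: the second
    coordinates of its two ends are a prescribed pair, to be solved for [p]. *)
Lemma mem_sdarts_lift (c : 5.-tuple T0) x y a b :
  (x, y) \in sdarts c ->
  exists p, (f (x, a), f (y, b)) \in sdarts (lift_cycle c p).
Proof.
move=> xyc.
suff [p dp]: exists p, ((x, a), (y, b)) \in sdarts (zip c (heights p)).
  by exists p; rewrite sdarts_map; apply/mapP; exists ((x, a), (y, b)).
case: c xyc => -[|v0 [|v1 [|v2 [|v3 [|v4 [|? ?]]]]]] //= sz.
rewrite /sdarts /darts /= !inE => xyc.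
do 9?[case/orP: xyc => [xyc|xyc]]; case/eqP: xyc => -> ->.
- by exists (a, b); rewrite !inE !xpair_eqE !eqxx /= ?orbT.
- by exists (b, a); rewrite !inE !xpair_eqE !eqxx /= ?orbT.
- by exists (a, b); rewrite !inE !xpair_eqE !eqxx /= ?orbT.
- by exists ((b - a)%R, a); rewrite !inE !xpair_eqE /= addrNK !eqxx /= ?orbT.
- exists (b, (a - b)%R); rewrite !inE !xpair_eqE /= [(b + _)%R]addrC addrNK.
  by rewrite !eqxx /= ?orbT.
- by exists (b, a); rewrite !inE !xpair_eqE !eqxx /= ?orbT.
- by exists (a, b); rewrite !inE !xpair_eqE !eqxx /= ?orbT.
- by exists (b, a); rewrite !inE !xpair_eqE !eqxx /= ?orbT.
- by exists ((a - b)%R, b); rewrite !inE !xpair_eqE /= addrNK !eqxx /= ?orbT.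
- exists (a, (b - a)%R); rewrite !inE !xpair_eqE /= [(a + _)%R]addrC addrNK.
  by rewrite !eqxx /= ?orbT.
Qed.

Lemma sdarts_lift (c : 5.-tuple T0) p d :
  d \in sdarts (lift_cycle c p) ->
  exists2 d0 : (T0 * 'I_k.+1) * (T0 * 'I_k.+1), d = (f d0.1, f d0.2)
    & (d0.1.1, d0.2.1) \in sdarts c.
Proof.
rewrite sdarts_map => /mapP[d0 d0c ->]; exists d0 => //.
(* c is the sequence of first coordinates of the cycle being lifted. *)
rewrite -[X in sdarts X](@unzip1_zip _ _ c (val (heights p))) ?size_tuple //.
by rewrite sdarts_map map_f.
Qed.

(** An edge determines the lift of [c] on which it lies: the vertices of [c] are
    distinct, so the projection of the edge locates it and its orientation on
    [c], and there the pair of second coordinates is injective in [p]. *)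
Lemma sdarts_lift_inj (c : 5.-tuple T0) p p' d :
  injective f -> uniq c ->
  d \in sdarts (lift_cycle c p) -> d \in sdarts (lift_cycle c p') -> p = p'.
Proof.
move=> f_inj Uc; rewrite !sdarts_map => /mapP[d0 dp ->].
case/mapP=> d1 dp' [/f_inj e1 /f_inj e2].
have {e1 e2 d1} dp' : d0 \in sdarts (zip c (heights p')).
  by rewrite [d0]surjective_pairing e1 e2 -surjective_pairing.
case: c Uc dp dp' => -[|v0 [|v1 [|v2 [|v3 [|v4 [|? ?]]]]]] //= sz.
rewrite !inE !negb_or -!andbA => U.
do 10![case/andP: U => /eqP ? U].
case: p p' => [a b] [a' b'] /= D D'.
(* Of the hundred pairs of positions of the edge on the two lifts, the ninety
   with distinct positions would identify two vertices of c. *)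
do 9?[case/orP: D => [D|D]]; move/eqP: D => D; subst d0;
  (do 9?[case/orP: D' => [D'|D']]); move/eqP: D' => D';
  try by exfalso; congruence.
all: case/(congr1 (fun d => (d.1.2, d.2.2)))/pair_equal_spec: D' => /= e1 e2;
  first [ by rewrite e1 e2
        | by move: e2; rewrite e1 => /addIr ->
        | by move: e2; rewrite e1 => /addrI ->
        | by move: e1; rewrite e2 => /addIr ->
        | by move: e1; rewrite e2 => /addrI -> ].
Qed.

End BlowUp.

Theorem blow_up_decomposition (T0 T : finType) (k : nat)
    (e0 : rel T0) (e : rel T) (f : T0 * 'I_k.+1 -> T) :
  bijective f ->
  (forall p q, e (f p) (f q) = e0 p.1 q.1) ->
  has_5cycle_decomposition e0 -> has_5cycle_decomposition e.
Proof.
move=> f_bij ef [P /decomposition_cycle_system[C [Ccyc Cinj Ccov]]].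
have f_inj := bij_inj f_bij.
pose C' := [set lift_cycle f c p | c in C, p in [set: 'I_k.+1 * 'I_k.+1]].
suff C'sys: cycle_system e C'.
  by eexists; apply: cycle_system_decomposition C'sys.
have C'cyc: {in C', forall c : 5.-tuple T, ucycle e c}.
  move=> _ /imset2P[c p /Ccyc/andP[cyc Uc] _ ->]; apply/andP; split.
    rewrite cycle_map; move: cyc {Uc}.
    case: c => -[|v0 [|v1 [|v2 [|v3 [|v4 [|? ?]]]]]] //= sz.
    by rewrite !ef.
  by rewrite map_inj_uniq //; apply: zip_uniql.
split=> //.
- move=> c1 c2 C1 C2 E Ec1 Ec2.
  case/andP: (C'cyc _ C1) => _ U1; case/andP: (C'cyc _ C2) => _ U2.
  case/imsetP: (Ec1) => x _ defE; move: (next _ x) defE => y defE.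
  rewrite defE !mem_cycle_edges // in Ec1 Ec2.
  case/imset2P: C1 Ec1 => c p Cc _ -> Ec1 {U1}.
  case/imset2P: C2 Ec2 => c' p' Cc' _ -> Ec2 {U2}.
  case/andP: (Ccyc c Cc) => _ Uc; case/andP: (Ccyc c' Cc') => _ Uc'.
  suff eq_c: c = c'.
    by rewrite -eq_c in Ec2 *; rewrite (sdarts_lift_inj f_inj Uc Ec1 Ec2).
  have [d def_xy dc] := sdarts_lift Ec1; rewrite def_xy in Ec2.
  have [d' [/f_inj eq1 /f_inj eq2] dc'] := sdarts_lift Ec2.
  rewrite -eq1 -eq2 -mem_cycle_edges // in dc'.
  rewrite -mem_cycle_edges // in dc.
  exact: Cinj dc dc'.
- move=> x y; have [g gK fK] := f_bij; rewrite -(fK x) -(fK y) ef.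
  case: (g x) (g y) => [x0 a] [y0 b] /= /Ccov[c Cc].
  case/andP: (Ccyc c Cc) => _ Uc; rewrite mem_cycle_edges // => xyc.
  have [p xyp] := mem_sdarts_lift f a b xyc.
  have C'c: lift_cycle f c p \in C' by apply: imset2_f.
  exists (lift_cycle f c p); rewrite ?mem_cycle_edges //.
  by case/andP: (C'cyc _ C'c).
Qed.

Lemma blow_up_tripartite (r s t k : nat) : 0 < k ->
  has_5cycle_decomposition (complete_tripartite r s t) ->
  has_5cycle_decomposition (complete_tripartite (r * k) (s * k) (t * k)).
Proof.
case: k => // k _.
pose f (p : tri_vertex r s t * 'I_k.+1) :
    tri_vertex (r * k.+1) (s * k.+1) (t * k.+1) :=
  match p.1 with
  | inl (inl i) => inl (inl (mxvec_index i p.2))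
  | inl (inr i) => inl (inr (mxvec_index i p.2))
  | inr i => inr (mxvec_index i p.2)
  end.
apply: (@blow_up_decomposition _ _ k _ _ f).
- have mxvec_inj m : injective (uncurry (@mxvec_index m k.+1)).
    have [g fK _] := curry_mxvec_bij m k.+1.
    by apply: (can_inj (g := g)) => z; apply: fK.
  apply: inj_card_bij; last first.
    by rewrite card_prod !card_sum !card_ord -!mulnDl.
  case=> [[[i|i]|i] a] [[[j|j]|j] b] //= eq_f.
  + by case: (mxvec_inj _ (i, a) (j, b) (inl_inj (inl_inj eq_f))) => -> ->.
  + by case: (mxvec_inj _ (i, a) (j, b) (inr_inj (inl_inj eq_f))) => -> ->.
  + by case: (mxvec_inj _ (i, a) (j, b) (inr_inj eq_f)) => -> ->.
- by case=> [[[i|i]|i] a] [[[j|j]|j] b].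
Qed.

(** * Decompositions given by lists of labelled cycles *)

Lemma uniq_flatten_map_inj (S U : eqType) (F : S -> seq U) (s : seq S) x y z :
  uniq (flatten (map F s)) ->
  x \in s -> y \in s -> z \in F x -> z \in F y -> x = y.
Proof.
elim: s => //= u s IH; rewrite cat_uniq => /and3P[_ /hasPn disj Us].
have sub w : w \in s -> z \in F w -> z \notin F u.
  by move=> ws zw; apply: disj; apply/flatten_mapP; exists w.
rewrite !inE => /orP[/eqP->|xs] /orP[/eqP->|ys] // zx zy.
- by have := sub _ ys zy; rewrite zx.
- by have := sub _ xs zx; rewrite zy.
- exact: IH.
Qed.

(** The multiset equality contains all three conditions on the cycles: their
    consecutive vertices are adjacent, every edge is covered, and, as no
    ordered pair is repeated, no edge is covered twice.  Labels, rather than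
    vertices, let a table of cycles be plain data that is compared by
    computation. *)
Lemma labelled_decomposition (T : finType) (e : rel T) (L : eqType)
    (label : T -> L) (cs : seq (seq L)) :
  injective label ->
  all (fun c => (size c == 5) && uniq c) cs ->
  perm_eq (flatten (map (@sdarts L) cs))
           [seq (label d.1, label d.2)
             | d <- enum [pred d : T * T | e d.1 d.2]] ->
  has_5cycle_decomposition e.
Proof.
move=> label_inj /allP cs5 csE.
pose pl (d : T * T) := (label d.1, label d.2).
have pl_inj : injective pl by move=> [x y] [x' y'] [/label_inj-> /label_inj->].
have csU : uniq (flatten (map (@sdarts L) cs)).
  by rewrite (perm_uniq csE) (map_inj_uniq pl_inj) enum_uniq.
have inE' x y : ((label x, label y) \in flatten (map (@sdarts L) cs)) = e x y.
  rewrite (perm_mem csE) -[(label x, _)]/(pl (x, y)) (mem_map pl_inj) mem_enum.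
  by rewrite inE.
pose C := [set c : 5.-tuple T | map label c \in cs].
suff Csys : cycle_system e C by eexists; apply: cycle_system_decomposition Csys.
have CU c : c \in C -> uniq c.
  by rewrite inE => /cs5/andP[_ /map_uniq].
have label_dart (c : seq T) d :
    d \in sdarts c -> pl d \in sdarts (map label c).
  by move=> dc; rewrite sdarts_map; apply/mapP; exists d.
split.
- move=> c cC; apply/andP; split; last exact: CU.
  rewrite cycle_darts; apply/allP=> d dc; rewrite -inE'.
  apply/flatten_mapP; exists (map label c); first by rewrite inE in cC.
  by apply: label_dart; rewrite mem_cat dc.
- move=> c c' cC c'C E Ec Ec'.
  case/imsetP: (Ec) => x _; move: (next _ x) => y defE.
  rewrite defE !mem_cycle_edges ?CU // in Ec Ec'.
  rewrite !inE in cC c'C; apply/val_inj/(inj_map label_inj).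
  apply: uniq_flatten_map_inj csU cC c'C (label_dart _ _ Ec) _.
  exact: label_dart Ec'.
- move=> x y; rewrite -inE' => /flatten_mapP[s s_cs xys].
  have [s5 Us] := andP (cs5 s s_cs).
  (* Each entry of s begins a dart of s, hence is the label of a vertex. *)
  have [c def_s] : exists c, s = map label c.
    have sub : {subset s <= codom label}.
      move=> u us; have : (u, next s u) \in flatten (map (@sdarts L) cs).
        apply/flatten_mapP; exists s => //.
        by rewrite mem_cat darts_next // map_f.
      by rewrite (perm_mem csE) => /mapP[d _ [-> _]]; apply: codom_f.
    elim: (s) sub => [|u s' IH] sub; first by exists [::].
    have [|c ->] := IH; first by move=> v vs'; apply: sub; rewrite inE vs' orbT.
    have /codomP[v ->] := sub u (mem_head _ _).
    by exists (v :: c).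
  rewrite def_s size_map in s5.
  have cC : Tuple s5 \in C by rewrite inE -def_s.
  exists (Tuple s5); rewrite // mem_cycle_edges ?CU //.
  move: xys; rewrite def_s sdarts_map.
  by case/mapP=> -[x' y'] xyc [/label_inj-> /label_inj->].
Qed.

Definition tri_label (r s t : nat) (v : tri_vertex r s t) : nat * nat :=
  (tri_part v,
   match v with
   | inl (inl i) => i : nat
   | inl (inr j) => j : nat
   | inr l => l : nat
   end).

Definition tri_labels (r s t : nat) : seq (nat * nat) :=
  [seq (0, i) | i <- iota 0 r] ++
  [seq (1, i) | i <- iota 0 s] ++
  [seq (2, i) | i <- iota 0 t].

Definition tri_darts (r s t : nat) :=
  [seq d <- [seq (x, y) | x <- tri_labels r s t, y <- tri_labels r s t]
     | d.1.1 != d.2.1].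

Lemma tri_label_inj r s t : injective (@tri_label r s t).
Proof. by case=> [[i|i]|i] [[j|j]|j] //= [] /val_inj ->. Qed.

Lemma enum_sum (T1 T2 : finType) :
  enum {: T1 + T2} = map inl (enum T1) ++ map inr (enum T2).
Proof. by rewrite !enumT [in LHS]unlock. Qed.

Lemma tri_labelsE r s t :
  tri_labels r s t = map (@tri_label r s t) (enum (tri_vertex r s t)).
Proof.
rewrite (enum_sum ('I_r + 'I_s)%type) enum_sum !map_cat -!map_comp -catA.
by rewrite /tri_labels -!val_enum_ord -!map_comp.
Qed.

Fixpoint lex (u v : seq nat) : bool :=
  match u, v with
  | i :: u', j :: v' => (i < j) || (i == j) && lex u' v'
  | _, _ => true
  end.

(** Lexicographic, the order in which [tri_darts] lists its entries. *)
Definition dart_le (d d' : (nat * nat) * (nat * nat)) : bool :=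
  lex [:: d.1.1; d.1.2; d.2.1; d.2.2] [:: d'.1.1; d'.1.2; d'.2.1; d'.2.2].

Lemma tripartite_decomposition (r s t : nat) (cs : seq (seq (nat * nat))) :
  all (fun c => (size c == 5) && uniq c) cs ->
  sort dart_le (flatten (map (@sdarts _) cs)) == tri_darts r s t ->
  has_5cycle_decomposition (complete_tripartite r s t).
Proof.
move=> cs5 /eqP csE; apply: (labelled_decomposition (@tri_label_inj r s t) cs5).
rewrite -(perm_sort dart_le) csE; apply: uniq_perm.
- have labels_uniq : uniq (tri_labels r s t).
    by rewrite tri_labelsE (map_inj_uniq (@tri_label_inj r s t)) enum_uniq.
  by rewrite filter_uniq // allpairs_uniq // => -[? ?] [? ?].
- rewrite map_inj_uniq ?enum_uniq // => -[u v] [u' v'] /=.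
  by case/pair_equal_spec=> /tri_label_inj-> /tri_label_inj->.
move=> d; rewrite mem_filter; apply/andP/mapP.
  case=> neq /allpairsP[[x y] /= [+ + def_d]]; rewrite !tri_labelsE.
  case/mapP=> u _ def_x /mapP[v _ def_y].
  exists (u, v); rewrite ?mem_enum ?inE -?def_x -?def_y //.
  by move: neq; rewrite def_d def_x def_y.
case=> [[u v]]; rewrite mem_enum inE => uv ->; split=> //.
apply/allpairsP; exists (tri_label u, tri_label v).
by split=> //=; rewrite tri_labelsE map_f ?mem_enum.
Qed.

(** * The two decompositions *)

(* Vertices of the first, second and third part. *)
Local Notation a i := (0, i) (only parsing).
Local Notation b i := (1, i) (only parsing).
Local Notation c i := (2, i) (only parsing).

(** A 5-cycle of a tripartite graph meets one part once and alternates between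
    the other two.  Each cycle is listed from its vertex in the part met once,
    and the cycles are grouped by that part: the third, the second, the first.
    The sizes 5, 32 and 70 of the groups are forced: such a cycle has three
    edges between the two parts that it meets twice and one edge between each
    other pair of parts, so that [9 * 13 = 107 + 2 * 5],
    [9 * 19 = 107 + 2 * 32] and [13 * 19 = 107 + 2 * 70]. *)
Definition cycles_9_13_19 : seq (seq (nat * nat)) :=
  [::
   [:: c 0; a 3; b 3; a 2; b 8]; [:: c 0; a 6; b 9; a 3; b 7];
   [:: c 4; a 1; b 11; a 8; b 5]; [:: c 4; a 3; b 1; a 5; b 10];
   [:: c 7; a 4; b 7; a 6; b 5]; [:: b 0; a 0; c 16; a 2; c 3];
   [:: b 0; a 6; c 18; a 1; c 5]; [:: b 0; a 7; c 14; a 3; c 1];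
   [:: b 1; a 7; c 3; a 3; c 8]; [:: b 1; a 8; c 6; a 6; c 13];
   [:: b 2; a 2; c 10; a 3; c 7]; [:: b 2; a 6; c 12; a 4; c 15];
   [:: b 4; a 3; c 18; a 4; c 2]; [:: b 4; a 6; c 4; a 8; c 1];
   [:: b 5; a 2; c 9; a 7; c 10]; [:: b 5; a 3; c 5; a 8; c 13];
   [:: b 5; a 5; c 10; a 6; c 17]; [:: b 5; a 7; c 7; a 8; c 16];
   [:: b 6; a 1; c 10; a 0; c 6]; [:: b 6; a 3; c 6; a 4; c 11];
   [:: b 6; a 4; c 17; a 8; c 3]; [:: b 6; a 7; c 15; a 5; c 9];
   [:: b 7; a 0; c 11; a 2; c 1]; [:: b 7; a 2; c 14; a 5; c 12];
   [:: b 7; a 5; c 7; a 2; c 4]; [:: b 7; a 7; c 6; a 1; c 3];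
   [:: b 8; a 5; c 13; a 0; c 12]; [:: b 8; a 6; c 5; a 5; c 2];
   [:: b 9; a 2; c 0; a 7; c 18]; [:: b 9; a 4; c 13; a 2; c 5];
   [:: b 10; a 1; c 16; a 5; c 1]; [:: b 10; a 6; c 2; a 0; c 18];
   [:: b 10; a 8; c 11; a 3; c 17]; [:: b 11; a 0; c 4; a 7; c 2];
   [:: b 11; a 2; c 15; a 6; c 3]; [:: b 11; a 7; c 11; a 6; c 8];
   [:: b 12; a 7; c 1; a 1; c 0]; [:: a 0; b 1; c 11; b 7; c 8];
   [:: a 0; b 2; c 12; b 1; c 5]; [:: a 0; b 3; c 18; b 7; c 14];
   [:: a 0; b 4; c 18; b 0; c 15]; [:: a 0; b 5; c 8; b 4; c 17];
   [:: a 0; b 6; c 1; b 1; c 9]; [:: a 0; b 8; c 4; b 6; c 0];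
   [:: a 0; b 9; c 11; b 2; c 3]; [:: a 0; b 10; c 13; b 6; c 7];
   [:: a 0; b 12; c 4; b 3; c 1]; [:: a 1; b 0; c 7; b 8; c 9];
   [:: a 1; b 1; c 14; b 5; c 12]; [:: a 1; b 2; c 1; b 12; c 14];
   [:: a 1; b 3; c 13; b 9; c 8]; [:: a 1; b 4; c 10; b 11; c 13];
   [:: a 1; b 5; c 3; b 10; c 15]; [:: a 1; b 7; c 17; b 3; c 2];
   [:: a 1; b 8; c 5; b 7; c 7]; [:: a 1; b 9; c 9; b 12; c 11];
   [:: a 1; b 12; c 15; b 1; c 17]; [:: a 2; b 0; c 11; b 8; c 8];
   [:: a 2; b 1; c 3; b 8; c 17]; [:: a 2; b 4; c 4; b 1; c 18];
   [:: a 2; b 6; c 12; b 9; c 2]; [:: a 2; b 10; c 11; b 11; c 12];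
   [:: a 2; b 12; c 7; b 4; c 6]; [:: a 3; b 0; c 14; b 11; c 15];
   [:: a 3; b 2; c 17; b 6; c 2]; [:: a 3; b 8; c 13; b 4; c 16];
   [:: a 3; b 10; c 16; b 0; c 12]; [:: a 3; b 11; c 17; b 0; c 13];
   [:: a 3; b 12; c 10; b 0; c 9]; [:: a 4; b 0; c 4; b 11; c 1];
   [:: a 4; b 1; c 7; b 3; c 10]; [:: a 4; b 2; c 16; b 6; c 8];
   [:: a 4; b 3; c 6; b 10; c 5]; [:: a 4; b 4; c 5; b 5; c 9];
   [:: a 4; b 5; c 0; b 4; c 3]; [:: a 4; b 8; c 10; b 9; c 4];
   [:: a 4; b 10; c 8; b 3; c 14]; [:: a 4; b 11; c 0; b 1; c 16];
   [:: a 4; b 12; c 18; b 2; c 0]; [:: a 5; b 0; c 6; b 11; c 18];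
   [:: a 5; b 2; c 9; b 7; c 6]; [:: a 5; b 3; c 3; b 12; c 17];
   [:: a 5; b 4; c 9; b 3; c 0]; [:: a 5; b 6; c 10; b 2; c 8];
   [:: a 5; b 9; c 6; b 5; c 11]; [:: a 5; b 11; c 7; b 9; c 3];
   [:: a 5; b 12; c 13; b 2; c 4]; [:: a 6; b 1; c 2; b 10; c 7];
   [:: a 6; b 3; c 16; b 11; c 9]; [:: a 6; b 6; c 18; b 8; c 1];
   [:: a 6; b 11; c 5; b 12; c 16]; [:: a 6; b 12; c 6; b 8; c 14];
   [:: a 7; b 2; c 2; b 7; c 13]; [:: a 7; b 3; c 11; b 4; c 12];
   [:: a 7; b 4; c 14; b 9; c 17]; [:: a 7; b 8; c 15; b 6; c 5];
   [:: a 7; b 9; c 0; b 0; c 8]; [:: a 7; b 10; c 10; b 7; c 16];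
   [:: a 8; b 0; c 2; b 12; c 8]; [:: a 8; b 2; c 6; b 1; c 10];
   [:: a 8; b 3; c 5; b 2; c 14]; [:: a 8; b 4; c 15; b 3; c 12];
   [:: a 8; b 6; c 14; b 10; c 9]; [:: a 8; b 7; c 15; b 5; c 2];
   [:: a 8; b 8; c 16; b 9; c 15]; [:: a 8; b 9; c 1; b 5; c 18];
   [:: a 8; b 12; c 12; b 10; c 0]].

(** Listed in the same way, in groups of 2, 57 and 80 cycles. *)
Definition cycles_11_13_23 : seq (seq (nat * nat)) :=
  [::
   [:: c 7; a 2; b 8; a 3; b 10]; [:: c 13; a 6; b 1; a 10; b 8];
   [:: b 0; a 2; c 13; a 5; c 5]; [:: b 0; a 6; c 4; a 5; c 21];
   [:: b 0; a 7; c 7; a 3; c 6]; [:: b 0; a 8; c 8; a 7; c 14];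
   [:: b 1; a 3; c 1; a 10; c 8]; [:: b 1; a 4; c 19; a 6; c 7];
   [:: b 1; a 5; c 9; a 10; c 5]; [:: b 1; a 7; c 5; a 4; c 4];
   [:: b 2; a 0; c 4; a 3; c 5]; [:: b 2; a 1; c 2; a 0; c 19];
   [:: b 2; a 2; c 6; a 5; c 22]; [:: b 2; a 3; c 20; a 1; c 1];
   [:: b 2; a 6; c 8; a 1; c 17]; [:: b 2; a 7; c 12; a 2; c 18];
   [:: b 2; a 8; c 21; a 1; c 0]; [:: b 3; a 0; c 6; a 7; c 2];
   [:: b 3; a 1; c 12; a 9; c 16]; [:: b 3; a 7; c 21; a 10; c 22];
   [:: b 3; a 10; c 18; a 8; c 5]; [:: b 4; a 0; c 0; a 4; c 1];
   [:: b 4; a 1; c 16; a 3; c 11]; [:: b 4; a 2; c 11; a 10; c 3];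
   [:: b 4; a 4; c 17; a 7; c 22]; [:: b 4; a 6; c 20; a 9; c 0];
   [:: b 4; a 9; c 15; a 2; c 19]; [:: b 4; a 10; c 17; a 3; c 12];
   [:: b 5; a 3; c 22; a 2; c 21]; [:: b 5; a 4; c 11; a 1; c 18];
   [:: b 5; a 6; c 14; a 4; c 6]; [:: b 6; a 0; c 20; a 2; c 5];
   [:: b 6; a 6; c 15; a 8; c 1]; [:: b 6; a 9; c 22; a 0; c 3];
   [:: b 6; a 10; c 15; a 5; c 11]; [:: b 7; a 6; c 11; a 0; c 16];
   [:: b 8; a 5; c 0; a 6; c 3]; [:: b 8; a 8; c 2; a 6; c 6];
   [:: b 8; a 9; c 19; a 7; c 18]; [:: b 9; a 1; c 15; a 0; c 13];
   [:: b 9; a 2; c 16; a 7; c 11]; [:: b 9; a 3; c 21; a 6; c 1];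
   [:: b 9; a 8; c 11; a 9; c 5]; [:: b 10; a 1; c 14; a 8; c 3];
   [:: b 10; a 4; c 10; a 9; c 8]; [:: b 10; a 6; c 18; a 4; c 13];
   [:: b 10; a 7; c 1; a 5; c 20]; [:: b 10; a 10; c 2; a 3; c 15];
   [:: b 11; a 0; c 5; a 1; c 4]; [:: b 11; a 1; c 7; a 0; c 17];
   [:: b 11; a 2; c 4; a 10; c 7]; [:: b 11; a 4; c 9; a 8; c 13];
   [:: b 11; a 8; c 12; a 10; c 10]; [:: b 11; a 9; c 9; a 6; c 22];
   [:: b 12; a 1; c 22; a 8; c 7]; [:: b 12; a 2; c 3; a 4; c 21];
   [:: b 12; a 5; c 2; a 9; c 1]; [:: b 12; a 8; c 10; a 3; c 18];
   [:: b 12; a 9; c 17; a 2; c 10]; [:: a 0; b 0; c 20; b 11; c 12];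
   [:: a 0; b 1; c 1; b 11; c 9]; [:: a 0; b 5; c 22; b 7; c 1];
   [:: a 0; b 7; c 0; b 9; c 21]; [:: a 0; b 8; c 22; b 0; c 18];
   [:: a 0; b 9; c 6; b 10; c 14]; [:: a 0; b 10; c 11; b 7; c 8];
   [:: a 0; b 12; c 4; b 8; c 10]; [:: a 1; b 0; c 12; b 3; c 10];
   [:: a 1; b 1; c 6; b 7; c 3]; [:: a 1; b 5; c 14; b 1; c 13];
   [:: a 1; b 6; c 15; b 12; c 19]; [:: a 1; b 7; c 19; b 1; c 9];
   [:: a 1; b 8; c 20; b 6; c 6]; [:: a 2; b 1; c 22; b 6; c 9];
   [:: a 2; b 3; c 21; b 10; c 1]; [:: a 2; b 5; c 12; b 8; c 2];
   [:: a 2; b 6; c 21; b 8; c 14]; [:: a 2; b 7; c 9; b 8; c 8];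
   [:: a 2; b 10; c 19; b 0; c 0]; [:: a 3; b 0; c 3; b 3; c 19];
   [:: a 3; b 3; c 18; b 4; c 9]; [:: a 3; b 4; c 17; b 12; c 3];
   [:: a 3; b 6; c 7; b 7; c 13]; [:: a 3; b 7; c 12; b 2; c 8];
   [:: a 3; b 11; c 21; b 1; c 0]; [:: a 3; b 12; c 13; b 3; c 14];
   [:: a 4; b 0; c 1; b 5; c 7]; [:: a 4; b 2; c 11; b 12; c 12];
   [:: a 4; b 3; c 8; b 6; c 2]; [:: a 4; b 6; c 16; b 12; c 22];
   [:: a 4; b 7; c 10; b 9; c 16]; [:: a 4; b 8; c 15; b 4; c 8];
   [:: a 4; b 9; c 14; b 4; c 20]; [:: a 4; b 12; c 14; b 11; c 15];
   [:: a 5; b 0; c 16; b 10; c 10]; [:: a 5; b 2; c 4; b 10; c 18];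
   [:: a 5; b 3; c 17; b 5; c 19]; [:: a 5; b 4; c 2; b 0; c 8];
   [:: a 5; b 5; c 15; b 9; c 17]; [:: a 5; b 6; c 10; b 2; c 7];
   [:: a 5; b 7; c 21; b 2; c 14]; [:: a 5; b 9; c 2; b 1; c 16];
   [:: a 5; b 10; c 9; b 5; c 3]; [:: a 5; b 11; c 2; b 10; c 12];
   [:: a 6; b 3; c 1; b 8; c 17]; [:: a 6; b 8; c 5; b 4; c 10];
   [:: a 6; b 9; c 18; b 7; c 5]; [:: a 6; b 11; c 19; b 9; c 12];
   [:: a 6; b 12; c 2; b 5; c 16]; [:: a 7; b 4; c 7; b 9; c 3];
   [:: a 7; b 5; c 4; b 4; c 13]; [:: a 7; b 6; c 0; b 5; c 20];
   [:: a 7; b 7; c 20; b 3; c 4]; [:: a 7; b 8; c 7; b 3; c 9];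
   [:: a 7; b 9; c 22; b 10; c 0]; [:: a 7; b 11; c 11; b 1; c 15];
   [:: a 7; b 12; c 9; b 0; c 10]; [:: a 8; b 1; c 12; b 6; c 4];
   [:: a 8; b 3; c 0; b 8; c 16]; [:: a 8; b 4; c 6; b 12; c 20];
   [:: a 8; b 5; c 11; b 8; c 19]; [:: a 8; b 6; c 13; b 0; c 17];
   [:: a 8; b 7; c 2; b 2; c 6]; [:: a 8; b 10; c 5; b 12; c 0];
   [:: a 9; b 0; c 15; b 2; c 13]; [:: a 9; b 1; c 20; b 9; c 4];
   [:: a 9; b 2; c 16; b 4; c 21]; [:: a 9; b 3; c 11; b 0; c 7];
   [:: a 9; b 5; c 10; b 1; c 3]; [:: a 9; b 7; c 17; b 6; c 14];
   [:: a 9; b 9; c 8; b 11; c 6]; [:: a 9; b 10; c 17; b 1; c 18];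
   [:: a 10; b 0; c 4; b 7; c 14]; [:: a 10; b 2; c 3; b 11; c 0];
   [:: a 10; b 5; c 5; b 11; c 16]; [:: a 10; b 7; c 15; b 3; c 6];
   [:: a 10; b 9; c 9; b 2; c 20]; [:: a 10; b 11; c 18; b 6; c 19];
   [:: a 10; b 12; c 8; b 5; c 13]].

Lemma decomposition_9_13_19 :
  has_5cycle_decomposition (complete_tripartite 9 13 19).
Proof.
by apply: (@tripartite_decomposition _ _ _ cycles_9_13_19); vm_compute.
Qed.

Lemma decomposition_11_13_23 :
  has_5cycle_decomposition (complete_tripartite 11 13 23).
Proof.
by apply: (@tripartite_decomposition _ _ _ cycles_11_13_23); vm_compute.
Qed.

Theorem proposition4p1 (k : nat) (hk : 0 < k) :
  has_5cycle_decomposition (complete_tripartite (9 * k) (13 * k) (19 * k)) /\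
  has_5cycle_decomposition (complete_tripartite (11 * k) (13 * k) (23 * k)).
Proof.
split; apply: blow_up_tripartite => //.
  exact: decomposition_9_13_19.
exact: decomposition_11_13_23.
Qed.
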